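(* Let $d$ and $r$ be integers with $1 \le r \le \frac{d}{2}$, and let $\Delta$ be an $(r-1)$-stacked $\mathbf{k}$-homology $(d-1)$-manifold without boundary, on vertex set $V$. If $\Sigma$ is an $(r-1)$-stacked $\mathbf{k}$-homology $d$-manifold with boundary such that $\partial\Sigma = \Delta$, then $\Sigma = \Delta(r)$, where $\Delta(r) = \{F \subseteq V : G \in \Delta \text{ for every } G \subseteq F \text{ with } \#G \le r+1\}$.
   Context: $\mathbf{k}$ is a fixed infinite field. For a finite simplicial complex $\Gamma$, $\beta_i(\Gamma) = \dim_{\mathbf{k}} \tilde H_i(\Gamma;\mathbf{k})$, and for a face $F$, $\mathrm{lk}_\Gamma(F) = \{G \in \Gamma : F\cup G \in \Gamma,\ F \cap G = \emptyset\}$. A face $F$ has dimension $\#F-1$. A complex $\Gamma$ of dimension $m$ is a $\mathbf{k}$-homology $m$-sphere if for every face $F$ (including $\emptyset$), $\beta_i(\mathrm{lk}_\Gamma F)=0$ for $i \ne m-\#F$ and $\beta_{m-\#F}(\mathrm{lk}_\Gamma F)=1$. A homology $m$-manifold without boundary is a pure $m$-dimensional complex all of whose vertex links are homology $(m-1)$-spheres. A pure $m$-dimensional complex $\Gamma$ is a homology $m$-manifold with boundary if (i) for every nonempty face $F$, $\beta_i(\mathrm{lk}_\Gamma F) = 0$ for $i \neq m-\#F$ and $\beta_{m-\#F}(\mathrm{lk}_\Gamma F) \in \{0,1\}$; (ii) the boundary $\partial\Gamma = \{F \in \Gamma : \beta_i(\mathrm{lk}_\Gamma F)=0 \text{ for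 all } i\}\cup\{\emptyset\}$ is a homology $(m-1)$-manifold without boundary. Faces not in $\partial\Gamma$ are interior faces. A homology $m$-manifold with boundary is $s$-stacked if it has no interior faces of dimension $\le m-s-1$; a homology manifold without boundary is $s$-stacked if it equals $\partial\Sigma$ for some $s$-stacked homology manifold with boundary $\Sigma$. *)

(* Defs.v *)
From HB Require Import structures.
From mathcomp Require Import all_boot all_order all_algebra.

Set Implicit Arguments.
Unset Strict Implicit.
Unset Printing Implicit Defensive.

Import Order.TTheory GRing.Theory Num.Theory.
Local Open Scope ring_scope.

Definition infinite_type (K : eqType) : Prop :=
  forall s : seq K, exists x : K, x \notin s.

(* A finite simplicial complex is a set of subsets of some finite type [T].
   Not every element of [T] has to be a vertex. Dimensions and homological
   degrees are integers, so that the empty face has dimension -1.             *)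

Section Complexes.

Variable T : finType.
Implicit Types (F G : {set T}) (Gam : {set {set T}}) (i m : int).

Definition is_complex Gam : Prop :=
  set0 \in Gam /\ (forall F G, F \in Gam -> G \subset F -> G \in Gam).

Definition vertex_set Gam : {set T} := [set v | [set v] \in Gam].

Definition face_dim F : int := #|F|%:Z - 1.

Definition complex_dim Gam : int := (\max_(F in Gam) #|F|)%:Z - 1.

Definition is_facet Gam F : bool := maxset (fun G => G \in Gam) F.

Definition pure_complex m Gam : Prop :=
  is_complex Gam /\ (forall F, is_facet Gam F -> face_dim F = m).

Definition link Gam F : {set {set T}} :=
  [set G in Gam | (F :|: G \in Gam) && (F :&: G == set0)].

(* [full_skel V Gam r] is Gam(r) for a complex Gam on the vertex set V. *)
Definition full_skel (V : {set T}) Gam (r : int) : {set {set T}} :=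
  [set F : {set T} | (F \subset V) &&
     [forall G : {set T}, (G \subset F) && (#|G|%:Z <= r + 1) ==> (G \in Gam)]].

End Complexes.

(* Reduced simplicial homology over [K]. All chain groups are subspaces of
   one space, with basis the subsets of [T]; simplices are oriented by the
   order in which [T] is enumerated, and the boundary of a vertex is the empty
   simplex (augmentation).                                                    *)

Section Homology.

Variables (K : fieldType) (T : finType).
Implicit Types (F G : {set T}) (Gam : {set {set T}}) (i : int).

Definition chain := {ffun {set T} -> K^o}.

Definition simplex F : chain := [ffun G => (G == F)%:R].

Definition vpos F (v : T) : nat :=
  #|[set u in F | (enum_rank u < enum_rank v)%N]|.

Definition bd_simplex F : chain :=
  \sum_(v in F) (-1) ^+ vpos F v *: simplex (F :\ v).

Definition bd_fun (c : chain) : chain := \sum_F c F *: bd_simplex F.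

Fact bd_fun_linear : linear bd_fun.
Proof.
move=> a x y; rewrite /bd_fun scaler_sumr -big_split /=.
by apply: eq_bigr => F _; rewrite !ffunE scalerDl scalerA.
Qed.

HB.instance Definition _ :=
  GRing.isLinear.Build K chain chain *:%R bd_fun bd_fun_linear.

Definition bd : 'End(chain) := linfun bd_fun.

Definition chains Gam i : {vspace chain} :=
  <<[seq simplex F | F <- enum Gam & face_dim F == i]>>%VS.

Definition cycles Gam i : {vspace chain} := (chains Gam i :&: lker bd)%VS.

Definition boundaries Gam i : {vspace chain} := (bd @: chains Gam (i + 1))%VS.

(* The dimension of the quotient of cycles by boundaries; the subtraction is
   not truncated, by [boundaries_sub_cycles] below.                           *)
Definition betti Gam i : nat := (\dim (cycles Gam i) - \dim (boundaries Gam i))%N.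

Lemma bd_simplexE F : bd (simplex F) = bd_simplex F.
Proof.
rewrite lfunE /= /bd_fun (bigD1 F) //= big1 => [|G neGF]; last first.
  by rewrite ffunE (negPf neGF) scale0r.
by rewrite ffunE eqxx scale1r addr0.
Qed.

Lemma vpos_gt F v w : (enum_rank w < enum_rank v)%N -> w \in F ->
  vpos F v = (vpos (F :\ w) v).+1.
Proof.
move=> ltwv Fw; rewrite /vpos (cardsD1 w) inE Fw ltwv add1n; congr _.+1.
by apply: eq_card => u; rewrite !inE andbA.
Qed.

Lemma vpos_lt F v w : (enum_rank w < enum_rank v)%N ->
  vpos (F :\ v) w = vpos F w.
Proof.
move=> ltwv; apply: eq_card => u; rewrite !inE.
by have [->|] := eqVneq u v; rewrite //= ltnNge (ltnW ltwv) andbF.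
Qed.

Lemma bd_bd_simplex F : bd (bd_simplex F) = 0.
Proof.
rewrite linear_sum /=.
pose t v w : chain := (-1) ^+ (vpos F v + vpos (F :\ v) w) *: simplex (F :\ v :\ w).
transitivity (\sum_(v in F) \sum_(w in F | w != v) t v w).
  apply: eq_bigr => v Fv; rewrite linearZ /= bd_simplexE scaler_sumr.
  apply: eq_big => [w|w _]; first by rewrite !inE andbC.
  by rewrite scalerA -exprD.
transitivity (\sum_(v in F) (\sum_(w in F | (enum_rank w < enum_rank v)%N) t v w +
                             \sum_(w in F | (enum_rank v < enum_rank w)%N) t v w)).
  apply: eq_bigr => v Fv.
  rewrite (bigID (fun w => (enum_rank w < enum_rank v)%N)) /=.
  congr (_ + _); apply: eq_bigl => w; rewrite -andbA; congr (_ && _);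
    rewrite -(inj_eq enum_rank_inj) -val_eqE /=; by case: ltngtP.
rewrite big_split /=.
rewrite [X in _ + X](exchange_big_dep (fun w => w \in F)) /=; last first.
  by move=> v w _ /andP[].
rewrite -big_split big1 //= => v Fv.
rewrite [X in _ + X](eq_bigl (fun w => (w \in F) && (enum_rank w < enum_rank v)%N)).
  rewrite -big_split big1 //= => w /andP[Fw ltwv].
  rewrite /t (vpos_gt ltwv Fw) (vpos_lt _ ltwv) addSn addnC exprS mulN1r scaleNr.
  by rewrite (_ : F :\ w :\ v = F :\ v :\ w) ?addNr // !setDDl setUC.
by move=> w; rewrite Fv.
Qed.

Lemma boundaries_sub_cycles Gam i :
  is_complex Gam -> (boundaries Gam i <= cycles Gam i)%VS.
Proof.
case=> _ Gdown; rewrite /boundaries limg_span; apply/span_subvP => c.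
case/mapP=> _ /mapP[F + ->] ->; rewrite mem_filter mem_enum => /andP[/eqP dF GF].
rewrite bd_simplexE memv_cap memv_ker bd_bd_simplex eqxx andbT.
apply: memv_suml => v Fv; apply/memvZ/memv_span/map_f.
rewrite mem_filter mem_enum (Gdown F) ?subD1set // andbT.
move: dF; rewrite /face_dim (cardsD1 v) Fv add1n intS => dF.
by rewrite -(inj_eq (addrI 1)) addrA dF addrC.
Qed.

(* A complex on [T] has no faces outside the dimensions -1, ..., #|T| - 1, so
   a bounded quantifier suffices; see [acyclicP].                             *)
Definition acyclic Gam : bool :=
  [forall j : 'I_(#|T|.+1), betti Gam (j%:Z - 1) == 0%N].

Lemma acyclicP Gam : reflect (forall i, betti Gam i = 0%N) (acyclic Gam).
Proof.
apply: (iffP forallP) => [ac i|ac j]; last exact/eqP.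
have [/hasP[F _ /eqP dF]|noF] := boolP (has (fun F => face_dim F == i) (enum Gam)).
  have ltF : (#|F| < #|T|.+1)%N by rewrite ltnS max_card.
  by move/eqP: (ac (Ordinal ltF)); rewrite -/(face_dim F) dF.
rewrite /betti /cycles /chains.
have -> : [seq F <- enum Gam | face_dim F == i] = [::].
  by apply/eqP; rewrite -[_ == _]negbK -has_filter.
by rewrite span_nil cap0v dimv0.
Qed.

End Homology.

Section Manifolds.

Variables (K : fieldType) (T : finType).
Implicit Types (F : {set T}) (Gam : {set {set T}}) (m s : int).

Definition homology_sphere m Gam : Prop :=
  [/\ is_complex Gam, complex_dim Gam = m &
      forall F, F \in Gam ->
        (forall i : int, i != m - #|F|%:Z -> betti K (link Gam F) i = 0%N) /\
        betti K (link Gam F) (m - #|F|%:Z) = 1%N].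

Definition homology_manifold m Gam : Prop :=
  pure_complex m Gam /\
  (forall v : T, [set v] \in Gam -> homology_sphere (m - 1) (link Gam [set v])).

Definition boundary Gam : {set {set T}} :=
  [set F in Gam | acyclic K (link Gam F)] :|: [set set0].

Definition homology_manifold_bd m Gam : Prop :=
  [/\ pure_complex m Gam,
      forall F, F \in Gam -> F != set0 ->
        (forall i : int, i != m - #|F|%:Z -> betti K (link Gam F) i = 0%N) /\
        (betti K (link Gam F) (m - #|F|%:Z) = 0%N \/
         betti K (link Gam F) (m - #|F|%:Z) = 1%N) &
      homology_manifold (m - 1) (boundary Gam)].

Definition interior_face Gam F : bool := (F \in Gam) && (F \notin boundary Gam).

Definition stacked_bd s m Gam : Prop :=
  homology_manifold_bd m Gam /\
  (forall F, interior_face Gam F -> ~~ (face_dim F <= m - s - 1)).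

End Manifolds.

(* The bounding manifold may have vertices outside [T], hence the embedding [f]. *)
Definition stacked (K : fieldType) (T : finType) (s m : int)
    (Gam : {set {set T}}) : Prop :=
  homology_manifold K m Gam /\
  exists (U : finType) (f : T -> U) (Sig : {set {set U}}),
    [/\ injective f, stacked_bd K s (m + 1) Sig &
        boundary K Sig = [set f @: F | F : {set T} in Gam]].

(* Main.v *)
Require Import Defs.
From mathcomp Require Import all_boot all_order all_algebra.
From mathcomp Require Import zify.
Import Order.TTheory GRing.Theory Num.Theory.
Local Open Scope ring_scope.

(** If [F] is a minimal non-face of [Sigma] and [v] is in [F], then [F :\ v] is
    a minimal non-face of the link [L] of [v]. Stackedness, together with the
    vanishing of the homology of links below the top degree, makes the
    homology of the link of every face of [L] (the empty one included) vanish
    in all degrees [>= r - 1]. This property passes to vertex deletions by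
    Mayer-Vietoris. Deleting all vertices outside [F :\ v] leaves the boundary
    of a simplex, which has homology in degree [#|F| - 3], so
    [#|F| <= r + 1]. *)

(** * Supports of chains and of their boundaries *)

Section Chains.

Set Implicit Arguments.
Unset Strict Implicit.

Variables (K : fieldType) (T : finType).
Implicit Types (F G : {set T}) (Gam : {set {set T}}) (i : int) (c b : chain K T).

(** Turns the span that defines [chains] into a condition on supports, so that membership can be
    checked one coefficient at a time. *)
Lemma mem_chainsP Gam i c :
  reflect (forall G, c G != 0 -> G \in Gam /\ face_dim G = i)
          (c \in chains K Gam i).
Proof.
apply: (iffP idP) => [cin G|csupp].
- set s := [seq simplex K F | F <- enum Gam & face_dim F == i].
  have /coord_span -> : c \in <<in_tuple s>>%VS by [].
  rewrite sum_ffunE => nz.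
  have [j nzj] : exists j : 'I_(size s), ((in_tuple s)`_j : chain K T) G != 0.
    apply/existsP; apply: contraNT nz; rewrite negb_exists => /forallP z.
    rewrite big1 // => j _; rewrite ffunE.
    by move: (z j); rewrite negbK => /eqP ->; rewrite scaler0.
  have : s`_j \in s by apply: mem_nth.
  case/mapP=> F; rewrite mem_filter mem_enum => /andP[/eqP dF GF] sE.
  move: nzj; rewrite /= sE ffunE; have [->|_] := eqVneq G F; first by [].
  by rewrite eqxx.
- have -> : c = \sum_F c F *: simplex K F.
    apply/ffunP=> G; rewrite sum_ffunE (bigD1 G) //= big1 => [|F neF].
      by rewrite addr0 !ffunE eqxx /GRing.scale /= mulr1.
    by rewrite !ffunE eq_sym (negPf neF) scaler0.
  apply: memv_suml => F _.
  have [->|/csupp[GF dF]] := eqVneq (c F) 0; first by rewrite scale0r mem0v.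
  apply/memvZ/memv_span/map_f.
  by rewrite mem_filter mem_enum GF dF eqxx.
Qed.

Lemma bdE c : bd K T c = \sum_F c F *: bd_simplex K F.
Proof. by rewrite lfunE. Qed.

Lemma bd_bd c : bd K T (bd K T c) = 0.
Proof.
rewrite [bd K T c]bdE linear_sum big1 // => F _.
by rewrite linearZ /= bd_bd_simplex scaler0.
Qed.

Lemma bd_support c G : bd K T c G != 0 ->
  exists F u, [/\ u \in F, c F != 0 & G = F :\ u].
Proof.
move=> nz.
have /existsP[F /existsP[u /and3P[Fu cF /eqP GE]]] :
    [exists F : {set T}, exists u, [&& u \in F, c F != 0 & G == F :\ u]].
  apply: contraNT nz; rewrite negb_exists => /forallP z.
  rewrite bdE sum_ffunE big1 // => F _; rewrite ffunE.
  have [->|cF] := eqVneq (c F) 0; first by rewrite scale0r.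
  rewrite /bd_simplex sum_ffunE big1 ?scaler0 // => u Fu; rewrite !ffunE.
  move: (z F); rewrite negb_exists => /forallP/(_ u).
  by rewrite Fu cF /= => /negPf ->; rewrite scaler0.
by exists F, u.
Qed.

(** The sets [F :\ v] are distinct for distinct [v], so nothing cancels and each coefficient is a
    sign. *)
Lemma bd_simplex_neq0 F : F != set0 -> bd_simplex K F != 0.
Proof.
case/set0Pn=> v Fv; apply/eqP => /ffunP/(_ (F :\ v)) /eqP.
rewrite /bd_simplex sum_ffunE (bigD1 v) //= big1 => [|u /andP[Fu neuv]].
  rewrite !ffunE eqxx addr0 /GRing.scale /= mulr1.
  by rewrite signr_eq0.
rewrite !ffunE; case: eqP => [/setP/(_ u)|_]; last by rewrite scaler0.
by rewrite !inE eqxx neuv Fu.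
Qed.

End Chains.

(** * Homology of links and of vertex deletions *)

Section Leray.

Set Implicit Arguments.
Unset Strict Implicit.

Variables (K : fieldType) (T : finType).
Implicit Types (F G : {set T}) (Gam : {set {set T}}) (i q : int).

Definition homology_vanishes Gam i : Prop :=
  forall c, c \in chains K Gam i -> bd K T c = 0 ->
  exists2 b, b \in chains K Gam (i + 1) & bd K T b = c.

Lemma betti0_vanishes Gam i :
  is_complex Gam -> betti K Gam i = 0%N -> homology_vanishes Gam i.
Proof.
move=> cG b0 c cin c0.
have sub := boundaries_sub_cycles K i cG.
have eqBZ : boundaries K Gam i = cycles K Gam i.
  by apply/eqP; rewrite eqEdim sub /= -subn_eq0; apply/eqP.
have : c \in cycles K Gam i by rewrite memv_cap cin memv_ker c0 eqxx.
by rewrite -eqBZ => /memv_imgP[b bin ->]; exists b.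
Qed.

(** The [q]-Leray property in its form for links; [G] may be empty, so [Gam] itself is covered. *)
Definition leray q Gam : Prop :=
  forall G i, G \in Gam -> q <= i -> homology_vanishes (link Gam G) i.

Definition deletion Gam (v : T) : {set {set T}} := [set G in Gam | v \notin G].

Lemma is_complex_link Gam F :
  is_complex Gam -> F \in Gam -> is_complex (link Gam F).
Proof.
case=> G0 Gdown GF; split=> [|G H]; first by rewrite !inE G0 setU0 GF setI0 eqxx.
rewrite !inE => /and3P[GG GFG FG0] HG.
rewrite (Gdown _ _ GG HG) (Gdown _ _ GFG (setUS _ HG)) /=.
by rewrite -subset0 -(eqP FG0) setIS.
Qed.

Lemma is_complex_deletion Gam v : is_complex Gam -> is_complex (deletion Gam v).
Proof.
case=> G0 Gdown; split=> [|G H]; first by rewrite !inE G0.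
rewrite !inE => /andP[GG vG] HG; rewrite (Gdown _ _ GG HG) /=.
by apply: contra vG; apply: (subsetP HG).
Qed.

Lemma link_link Gam F G : is_complex Gam ->
  G \in link Gam F -> link (link Gam F) G = link Gam (F :|: G).
Proof.
case=> _ Gdown; rewrite inE => /and3P[GG GFG FG0]; apply/setP=> H.
rewrite !inE !setIUl !setU_eq0 !setIUr !setU_eq0 FG0 setUA /=.
apply/idP/idP.
  by case/andP=> /and3P[-> _ ->] /andP[/and3P[_ -> _]] ->.
case/and3P=> -> GFGH /andP[-> ->]; rewrite GFGH !andbT /=.
apply/andP; split; apply: Gdown GFGH _; last by rewrite -setUA subsetUr.
by rewrite setSU // subsetUl.
Qed.

Lemma link_deletion Gam v G : v \notin G ->
  link (deletion Gam v) G = deletion (link Gam G) v.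
Proof.
move=> vG; apply/setP=> H; rewrite !inE (negPf vG) /=.
by case: (v \in H); rewrite ?andbF ?andbT.
Qed.

Lemma deletion_nonvertex Gam v : is_complex Gam ->
  [set v] \notin Gam -> deletion Gam v = Gam.
Proof.
case=> _ Gdown nv; apply/setP=> G; rewrite inE.
case GG: (G \in Gam) => //=; apply: contra nv => vG.
by apply: Gdown GG _; rewrite sub1set.
Qed.

(* One step of Mayer-Vietoris for the star and the deletion of [v]. *)
Lemma deletion_vanishes Gam v i : is_complex Gam ->
  homology_vanishes Gam i -> homology_vanishes (link Gam [set v]) i ->
  homology_vanishes (deletion Gam v) i.
Proof.
case=> _ Gdown HG HL c /mem_chainsP cin c0.
have cG : c \in chains K Gam i.
  by apply/mem_chainsP=> G /cin[]; rewrite inE => /andP[].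
have [b /mem_chainsP bin bc] := HG c cG c0.
(* The filling [b] of [c] in [Gam] splits into [b0], which lies in the deletion, and [b - b0], which
   lies in the star of [v]. *)
pose b0 : chain K T := [ffun G : {set T} => if v \in G then 0 else b G].
have b0P (G : {set T}) : b0 G != 0 -> v \notin G /\ b G != 0.
  by rewrite ffunE; case: ifP => //; rewrite eqxx.
have b1P (G : {set T}) : (b - b0) G != 0 -> v \in G /\ b G != 0.
  rewrite !ffunE; case: ifP => _; first by rewrite oppr0 addr0.
  by rewrite subrr eqxx.
pose e := c - bd K T b0.
have e1 : e = bd K T (b - b0) by rewrite /e -bc linearB.
have ve (G : {set T}) : e G != 0 -> v \notin G.
  apply: contraNN => vG; rewrite /e !ffunE.
  have [->|/cin[]] := eqVneq (c G) 0; last by rewrite inE vG andbF.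
  have [->|/bd_support[F [u [_ /b0P[vF _] GE]]]] := eqVneq (bd K T b0 G) 0.
    by rewrite subrr.
  by move: vG; rewrite GE !inE (negPf vF) andbF.
(* A set in the support of [e] avoids [v] but is a facet of some face containing [v], so it is that
   face minus [v]. *)
have eL : e \in chains K (link Gam [set v]) i.
  apply/mem_chainsP=> G eG; have vG := ve G eG.
  move: eG; rewrite e1 => /bd_support[F [u [Fu /b1P[vF /bin[GF dF]] GE]]].
  have uv : u = v.
    by apply/esym/eqP; move: vG; rewrite GE !inE vF andbT negbK.
  move: Fu GE; rewrite {}uv => _ GE; split; last first.
    by move: dF; rewrite GE /face_dim (cardsD1 v F) vF; lia.
  rewrite !inE {2}GE setD1K // GF (Gdown F) ?GE ?subD1set //=.
  by rewrite setI_eq0 disjoints1 !inE eqxx.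
have e0 : bd K T e = 0 by rewrite /e linearB /= c0 bd_bd subrr.
have [e' /mem_chainsP e'in e'E] := HL e eL e0.
(* Replacing the star part of [b] by a filling of [e] in the link gives a filling of [c] that avoids
   [v]. *)
exists (b0 + e'); last by rewrite linearD /= e'E addrC subrK.
apply/mem_chainsP=> G; rewrite ffunE => nz.
have [z|/b0P[vG /bin[GG ->]]] := eqVneq (b0 G) 0; last by rewrite inE GG vG.
move: nz; rewrite z add0r => /e'in[]; rewrite !inE => /and3P[-> _ vG] ->.
by rewrite setI_eq0 disjoints1 in vG.
Qed.

(** Links in the deletion are deletions of links, and the two complexes to which [deletion_vanishes]
    is applied, the link of [G] and the link of [v] in it, are both links in [Gam]. *)
Lemma leray_deletion q Gam v :
  is_complex Gam -> leray q Gam -> leray q (deletion Gam v).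
Proof.
move=> cG lG G i; rewrite inE => /andP[GG vG] qi.
have cL := is_complex_link cG GG.
rewrite link_deletion //.
have [vL|nvL] := boolP ([set v] \in link Gam G); last first.
  by rewrite deletion_nonvertex //; apply: lG.
apply: deletion_vanishes => //; first exact: lG.
rewrite link_link //; apply: lG => //.
by move: vL; rewrite inE => /and3P[].
Qed.

(** * Missing faces *)

Lemma link0 Gam : link Gam set0 = Gam.
Proof. by apply/setP=> G; rewrite inE set0U set0I eqxx andbT andbb. Qed.

(** Induction on the number of faces: deleting a vertex outside [F] keeps all hypotheses. Once no
    such vertex is left, the boundary of the simplex [F] is a cycle of degree [#|F| - 2] that bounds
    nothing, so this degree is below [q]. *)
Lemma leray_missing_face q Gam F : is_complex Gam -> leray q Gam ->
  F != set0 -> F \notin Gam -> (forall G, G \proper F -> G \in Gam) ->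
  #|F|%:Z <= q + 1.
Proof.
have [n] := ubnP #|Gam|.
elim: n Gam => // n IHn Gam ltn cG lG F0 nF pF.
have [/existsP[v /andP[vGam vF]]|] :=
    boolP [exists v, ([set v] \in Gam) && (v \notin F)].
  apply: (IHn (deletion Gam v)) => //; last 1 first.
  - move=> G GF; rewrite inE pF //=; apply: contra vF.
    by apply: (subsetP (proper_sub GF)).
  - apply: (leq_trans (proper_card _) ltn); apply/properP; split.
      by apply/subsetP=> G; rewrite inE => /andP[].
    by exists [set v]; rewrite // !inE eqxx andbF.
  - exact: is_complex_deletion.
  - exact: leray_deletion.
  - by rewrite inE negb_and nF.
rewrite negb_exists => /forallP allF; rewrite leNgt; apply/negP => ltqF.
have GsubF G : G \in Gam -> G \subset F.
  move=> GG; apply/subsetP=> v vG; move: (allF v).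
  by rewrite (proj2 cG G [set v]) ?sub1set //= negbK.
have q_le : q <= face_dim F - 1 by rewrite /face_dim; lia.
have := lG set0 _ (proj1 cG) q_le; rewrite link0.
case/(_ (bd_simplex K F)).
- apply/mem_chainsP=> G; rewrite -bd_simplexE => /bd_support[H [u [Hu nz ->]]].
  have HF : H = F by apply: contraNeq nz => /negPf HF; rewrite ffunE HF.
  rewrite {}HF in Hu *; split; first by apply: pF; rewrite properD1.
  by rewrite /face_dim (cardsD1 u F) Hu; lia.
- exact: bd_bd_simplex.
move=> b /mem_chainsP bin bE.
(* A face of dimension [face_dim F] contained in [F] is [F] itself, which is not in [Gam]. *)
have b0 : b = 0.
  apply/ffunP=> G; rewrite [RHS]ffunE; apply/eqP; apply: contraNT nF => /bin[GG dG].
  suff <- : G = F by [].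
  apply/eqP; rewrite eqEcard GsubF //=; move: dG; rewrite /face_dim; lia.
by move: (bd_simplex_neq0 K F0); rewrite -bE b0 linear0 eqxx.
Qed.

Lemma missing_face_link Gam F v : v \in F -> F \notin Gam ->
  (forall G, G \proper F -> G \in Gam) ->
  F :\ v \notin link Gam [set v] /\
  (forall G, G \proper F :\ v -> G \in link Gam [set v]).
Proof.
move=> vF nF pF; split; first by rewrite !inE setD1K // (negPf nF) andbF.
move=> G GF; have /properP[sGF [w wF wG]] := GF.
have vG : v \notin G by apply/negP => /(subsetP sGF); rewrite !inE eqxx.
rewrite inE setI_eq0 disjoints1 vG andbT; apply/andP; split; apply: pF.
  by apply: proper_sub_trans GF _; rewrite subD1set.
apply/properP; split; last first.
  move: wF; rewrite !inE => /andP[wv wF].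
  by exists w; rewrite // !inE negb_or wv.
by rewrite subUset sub1set vF (subset_trans sGF) ?subD1set.
Qed.

(** * Vertex links in stacked manifolds *)

Lemma stacked_small_face s m Gam F : stacked_bd K s m Gam ->
  F \in Gam -> face_dim F <= m - s - 1 -> F \in boundary K Gam.
Proof.
case=> _ st GF small; apply: contraTT small => nb.
by apply: st; rewrite /interior_face GF.
Qed.

(** Links in the link of [v] are links of nonempty faces of [Gam], with homology at most in top
    degree. If that degree is at least [s], the face is too small to be interior, and its link is
    acyclic. *)
Lemma stacked_link_leray s m Gam v : stacked_bd K s m Gam ->
  [set v] \in Gam -> leray s (link Gam [set v]).
Proof.
move=> st Gv G i GL si; have [[[cG _] homG _] _] := st.
rewrite link_link //.
have GvG : [set v] :|: G \in Gam by move: GL; rewrite inE => /and3P[].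
have ne0 : [set v] :|: G != set0.
  by apply/set0Pn; exists v; rewrite !inE eqxx.
apply: betti0_vanishes; first exact: is_complex_link.
have [vanish _] := homG _ GvG ne0.
have [iE|] := eqVneq i (m - #|[set v] :|: G|%:Z); last exact: vanish.
have /(stacked_small_face st GvG) : face_dim ([set v] :|: G) <= m - s - 1.
  by rewrite /face_dim; lia.
by rewrite !inE (negPf ne0) orbF => /andP[_ /acyclicP].
Qed.

End Leray.

Theorem theorem4p2 (K : fieldType) (K_inf : infinite_type K) (T : finType)
    (d r : int) (V : {set T}) (Delta Sigma : {set {set T}})
    (r_ge1 : 1 <= r) (r_le : 2 * r <= d)
    (V_def : V = vertex_set Delta)
    (Delta_stacked : stacked K (r - 1) (d - 1) Delta)
    (Sigma_stacked : stacked_bd K (r - 1) d Sigma)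
    (bd_Sigma : boundary K Sigma = Delta) :
  Sigma = full_skel V Delta r.
Proof.
have [[[cS _] _ _] _] := Sigma_stacked.
have [S0 Sdown] := cS.
(* Interior faces have dimension above [d - r], while here the dimension is at most [r <= d - r]. *)
have small F : F \in Sigma -> #|F|%:Z <= r + 1 -> F \in Delta.
  move=> SF cF; rewrite -bd_Sigma; apply: (stacked_small_face Sigma_stacked SF).
  by rewrite /face_dim; lia.
have subDS F : F \in Delta -> F \in Sigma.
  by rewrite -bd_Sigma !inE => /orP[/andP[]|/eqP ->].
apply/setP=> F; rewrite inE; apply/idP/andP => [SF|[_ /forallP skF]].
  split.
    apply/subsetP=> v vF; rewrite V_def inE; apply: small; last by rewrite cards1; lia.
    by apply: Sdown SF _; rewrite sub1set.
  apply/forallP=> G; apply/implyP=> /andP[GF cG]; apply: small => //.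
  exact: Sdown SF GF.
apply: contraT => nSF.
(* A minimal non-face [M] inside [F] is too large for the skeleton condition to apply to it. *)
have [M /minsetP[nSM minM] MF] := minset_exists (P := fun G => G \notin Sigma) nSF.
have pM (G : {set T}) : G \proper M -> G \in Sigma.
  move=> GM; apply: contraT => nSG.
  by have GE := minM G nSG (proper_sub GM); rewrite GE properxx in GM.
have cM : r + 1 < #|M|%:Z.
  rewrite ltNge; apply: contra nSM => cM; apply: subDS.
  by apply: (implyP (skF M)); rewrite MF.
have /card_gt0P[v vM] : (0 < #|M|)%N by lia.
have cMv := cardsD1 v M; rewrite vM in cMv.
have [nL pL] := missing_face_link vM nSM pM.
have Sv : [set v] \in Sigma.
  by apply: pM; rewrite properEcard sub1set vM cards1; lia.
have Mv0 : M :\ v != set0 by rewrite -card_gt0; lia.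
(* With [q = r - 1] this gives [#|M| - 1 <= r], against [cM]. *)
have := leray_missing_face (is_complex_link cS Sv)
          (stacked_link_leray Sigma_stacked Sv) Mv0 nL pL.
lia.
Qed.
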